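(* (1) For any $\lambda\in[0,1)$: $\omega\text{-}\mathrm{RL}\not\subseteq\mathbb{L}^{>\lambda}(\mathrm{QBA}|\mathrm{ND})$. (2) For any $\lambda\in[0,1)$: $\omega\text{-}\mathrm{CFL}\setminus\omega\text{-}\mathrm{RL}\not\subseteq\mathbb{L}^{>\lambda}(\mathrm{QBA}|\mathrm{ND})$. (3) For any $\lambda\in(0,1)$: $\mathbb{L}^{>\lambda}(\mathrm{QBA}|\mathrm{ND})\not\subseteq\omega\text{-}\mathrm{RL}$. (4) $\mathbb{L}^{=1}(\mathrm{QBA}|\mathrm{ND})\not\subseteq\omega\text{-}\mathrm{RL}$. (5) $\mathbb{L}^{=1}(\mathrm{QBA}|\mathrm{ND})\not\subseteq\omega\text{-}\mathrm{CFL}$.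
   Context: A quantum automaton is a tuple $\mathcal{A}=(\mathcal{H},|s_0\rangle,\Sigma,\{U_\sigma:\sigma\in\Sigma\},F)$ where $\mathcal{H}$ is a finite-dimensional complex Hilbert space, $|s_0\rangle$ a unit vector, $\Sigma$ a finite alphabet, each $U_\sigma$ unitary, and $F$ a subspace. For $w=\sigma_1\sigma_2\cdots\in\Sigma^\omega$ the non-disturbing run is $|s_n\rangle=U_{\sigma_n}\cdots U_{\sigma_1}|s_0\rangle$, and $f^{\mathrm{ND}}_{\mathcal{A}}(w)=\sup_{|\psi\rangle}\sup_{\{n_i\}}\inf_{i\ge1}|\langle\psi|s_{n_i}\rangle|^2$ (sup over unit $|\psi\rangle\in F$ and strictly increasing sequences $0\le n_1<n_2<\cdots$). $\mathcal{L}^{>\lambda}(\mathcal{A}|\mathrm{ND})=\{w:f^{\mathrm{ND}}_{\mathcal{A}}(w)>\lambda\}$, $\mathcal{L}^{=1}(\mathcal{A}|\mathrm{ND})=\{w:f^{\mathrm{ND}}_{\mathcal{A}}(w)=1\}$; $\mathbb{L}^{>\lambda}(\mathrm{QBA}|\mathrm{ND})$ and $\mathbb{L}^{=1}(\mathrm{QBA}|\mathrm{ND})$ are the classes of all such languages over all quantum automata. $\omega\text{-}\mathrm{RL}$ (resp. $\omega\text{-}\mathrm{CFL}$), the $\omega$-regular (resp. $\omega$-context-free) languages, is the class of all $\omega$-languages of the form $\bigcup_{i=1}^n U_iV_i^\omega$ with $n\in\mathbb{N}$ and $U_i,V_i$ regular (resp. context-free) languages of finite words, where $V^\omega$ is the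 set of infinite concatenations of nonempty words from $V$. *)

(* Defs.v *)
From HB Require Import structures.
From mathcomp Require Import all_boot all_order all_algebra.
From mathcomp Require Import complex.
From mathcomp Require Import classical_sets reals Rstruct.

Set Implicit Arguments.
Unset Strict Implicit.
Unset Printing Implicit Defensive.

Import Order.TTheory GRing.Theory Num.Theory.
Local Open Scope ring_scope.

Notation C := (complex Rdefinitions.R).

Definition oword (S : finType) := nat -> S.
Definition lang (S : finType) := seq S -> Prop.
Definition olang (S : finType) := oword S -> Prop.

Record dfa (S : finType) := DFA {
  dfa_state : finType;
  dfa_init : dfa_state;
  dfa_trans : dfa_state -> S -> dfa_state;
  dfa_final : pred dfa_state }.
Arguments dfa_init {S} d.
Arguments dfa_trans {S} d _ _.
Arguments dfa_final {S} d _.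

Definition dfa_accepts (S : finType) (A : dfa S) (u : seq S) : bool :=
  dfa_final A (foldl (dfa_trans A) (dfa_init A) u).

Definition regular (S : finType) (L : lang S) : Prop :=
  exists A : dfa S, forall u, L u <-> dfa_accepts A u.

Record cfg (S : finType) := CFG {
  cfg_nt : finType;
  cfg_start : cfg_nt;
  cfg_rules : seq (cfg_nt * seq (cfg_nt + S)) }.
Arguments cfg_start {S} c.
Arguments cfg_rules {S} c.

Inductive gen (S : finType) (G : cfg S) : cfg_nt G -> seq S -> Prop :=
| gen_rule X rhs w :
    (X, rhs) \in cfg_rules G -> @gens S G rhs w -> @gen S G X w
with gens (S : finType) (G : cfg S) : seq (cfg_nt G + S) -> seq S -> Prop :=
| gens_nil : @gens S G [::] [::]
| gens_t a r w : @gens S G r w -> @gens S G (inr a :: r) (a :: w)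
| gens_nt Y r u v :
    @gen S G Y u -> @gens S G r v -> @gens S G (inl Y :: r) (u ++ v).

Definition context_free (S : finType) (L : lang S) : Prop :=
  exists G : cfg S, forall u, L u <-> @gen S G (cfg_start G) u.

(* V^omega: infinite concatenations of nonempty words of V; the breakpoints
   b 0 = 0 < b 1 < b 2 < ... cut w into the factors w[b k, b (k+1)). *)
Definition omega_pow (S : finType) (V : lang S) : olang S :=
  fun w => exists b : nat -> nat, b 0 = 0%N /\ (forall k, (b k < b k.+1)%N) /\
    forall k, V [seq w i | i <- iota (b k) (b k.+1 - b k)].

Definition oconcat (S : finType) (u : seq S) (w : oword S) : oword S :=
  fun i => if (i < size u)%N then nth (w 0%N) u i else w (i - size u)%N.

Definition lconcat (S : finType) (U : lang S) (L : olang S) : olang S :=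
  fun w => exists u w', U u /\ L w' /\ forall i, w i = oconcat u w' i.

Definition omega_regular (S : finType) (L : olang S) : Prop :=
  exists (n : nat) (U V : nat -> lang S),
    (forall i, (i < n)%N -> regular (U i) /\ regular (V i)) /\
    forall w, L w <-> exists2 i, (i < n)%N & lconcat (U i) (omega_pow (V i)) w.

Definition omega_cf (S : finType) (L : olang S) : Prop :=
  exists (n : nat) (U V : nat -> lang S),
    (forall i, (i < n)%N -> context_free (U i) /\ context_free (V i)) /\
    forall w, L w <-> exists2 i, (i < n)%N & lconcat (U i) (omega_pow (V i)) w.

Definition dotc (d : nat) (u v : 'cV[C]_d) : C := \sum_i conjc (u i 0) * v i 0.

Definition adjmx (d : nat) (U : 'M[C]_d) : 'M[C]_d := map_mx conjc U^T.

Definition unitary (d : nat) (U : 'M[C]_d) : Prop := adjmx U *m U = 1%:M.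

Definition sqmod (z : C) : Rdefinitions.R :=
  complex.Re z ^+ 2 + complex.Im z ^+ 2.

(* the subspace F is the row space of the matrix F; psi belongs to it iff
   psi^T lies in that row space *)
Definition in_subspace (d : nat) (F : 'M[C]_d) (psi : 'cV[C]_d) : bool :=
  (psi^T <= F)%MS.

Record qa (S : finType) := QA {
  qa_dim : nat;
  qa_s0 : 'cV[C]_qa_dim;
  qa_U : S -> 'M[C]_qa_dim;
  qa_F : 'M[C]_qa_dim;
  qa_s0_unit : dotc qa_s0 qa_s0 = 1;
  qa_U_unitary : forall a, unitary (qa_U a) }.
Arguments qa_dim {S} q.
Arguments qa_s0 {S} q.
Arguments qa_U {S} q _.
Arguments qa_F {S} q.

(* |s_n> = U_{sigma_n} ... U_{sigma_1} |s_0>, with sigma_{k+1} = w k *)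
Fixpoint qa_run (S : finType) (A : qa S) (w : oword S) (n : nat)
  : 'cV[C]_(qa_dim A) :=
  match n with
  | 0 => qa_s0 A
  | n.+1 => qa_U A (w n) *m qa_run A w n
  end.

Definition f_ND (S : finType) (A : qa S) (w : oword S) : Rdefinitions.R :=
  sup (fun x : Rdefinitions.R =>
    exists psi : 'cV[C]_(qa_dim A),
      in_subspace (qa_F A) psi /\ dotc psi psi = 1 /\
      exists n : nat -> nat, (forall i, (n i < n i.+1)%N) /\
        x = inf (fun y : Rdefinitions.R =>
                   exists i, y = sqmod (dotc psi (qa_run A w (n i))))).

Definition L_gt (S : finType) (lam : Rdefinitions.R) (A : qa S) : olang S :=
  fun w => lam < f_ND A w.

Definition L_eq1 (S : finType) (A : qa S) : olang S :=
  fun w => f_ND A w = 1.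

Definition in_QBA_gt (S : finType) (lam : Rdefinitions.R) (L : olang S) : Prop :=
  exists A : qa S, forall w, L w <-> L_gt lam A w.

(* Main.v *)
Require Import Defs.
From mathcomp Require Import all_boot all_order all_algebra.
From mathcomp Require Import complex spectral.
From mathcomp Require Import boolp classical_sets reals Rstruct.
From mathcomp Require Import zify ring lra.
Import Order.TTheory GRing.Theory Num.Theory.
Set Implicit Arguments.
Unset Strict Implicit.
Unset Printing Implicit Defensive.
Local Open Scope ring_scope.

(** A letter c that acts as the identity makes the words u c^omega probe a quantum automaton
    after the finite word u.

    (1), (2): some positive power of a unitary nearly fixes the initial state, so with w also
    a^m w lies above the threshold for some m > 0; but {c^omega} and {a^n b^n c^omega}
    contain no a^m c^omega with m > 0.  An omega-regular language has finitely many left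
    quotients, which {a^n b^n c^omega} has not.

    (3), (4), (5): let the letter a_i multiply the i-th of k coordinates by some z of modulus 1,
    not a root of unity, starting from the uniform superposition.  Observed in that same
    superposition, u c^omega has value 1 iff all a_i occur equally often in u; for k = 3
    this is not omega-context-free.  For k = 2, observe instead in a direction where each
    a_0^n a_1^n c^omega has value exactly lam.  If a_0^i and a_0^j had the same left
    quotient with z^i close to, but different from, z^j, then neither a_0^i a_1^j c^omega nor
    a_0^j a_1^i c^omega would exceed lam, yet the small rotations z^(i-j) and z^(j-i)
    move the value in opposite directions. *)

Local Notation R := Rdefinitions.R.

(** * Infinite words *)

Section InfiniteWords.
Variable S : finType.
Implicit Types (u v x y : seq S) (w : oword S) (c : S) (U V : lang S).

Definition oshift (n : nat) w : oword S := fun i => w (n + i)%N.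

Definition ocst c : oword S := fun=> c.

Definition factor w (i n : nat) : seq S := [seq w j | j <- iota i n].

Definition occurs_at w (i : nat) u : Prop := u = factor w i (size u).

Lemma size_factor w i n : size (factor w i n) = n.
Proof. by rewrite size_map size_iota. Qed.

Lemma factor_oshift m w i n : factor (oshift m w) i n = factor w (m + i) n.
Proof. by rewrite /factor iotaDl -map_comp. Qed.

Lemma oshiftD m n w : oshift (m + n) w = oshift n (oshift m w).
Proof. by apply: funext => i; rewrite /oshift addnA. Qed.

Lemma oconcat_lt u w i s0 : (i < size u)%N -> oconcat u w i = nth s0 u i.
Proof. by move=> lt_iu; rewrite /oconcat lt_iu; apply: set_nth_default. Qed.

Lemma oshift_oconcat u w : oshift (size u) (oconcat u w) = w.
Proof. by apply: funext => i; rewrite /oshift /oconcat ltnNge leq_addr addKn. Qed.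

Lemma oconcat_inj u : injective (oconcat u).
Proof. by move=> w w' /(congr1 (oshift (size u))); rewrite !oshift_oconcat. Qed.

Lemma oconcat_nil w : oconcat [::] w = w.
Proof. by apply: funext => i; rewrite /oconcat subn0. Qed.

Lemma oconcat_cat u v w : oconcat (u ++ v) w = oconcat u (oconcat v w).
Proof.
apply: funext => i; rewrite /oconcat size_cat nth_cat.
have [lt_iu|le_ui] := ltnP i (size u).
  by rewrite (leq_trans lt_iu (leq_addr _ _)); apply: set_nth_default.
by rewrite ltn_subLR // subnDA.
Qed.

Lemma mkseq_oconcat u w : mkseq (oconcat u w) (size u) = u.
Proof.
apply: (@eq_from_nth _ (w 0%N)) => [|i]; rewrite size_mkseq // => lt_iu.
by rewrite nth_mkseq //; apply: oconcat_lt.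
Qed.

Lemma mkseqD w m n : mkseq w (m + n) = mkseq w m ++ mkseq (oshift m w) n.
Proof. by rewrite /mkseq iotaD map_cat -!/(factor _ _ _) factor_oshift addn0. Qed.

Lemma mkseq_oconcat_add u w n :
  mkseq (oconcat u w) (size u + n) = u ++ mkseq w n.
Proof. by rewrite mkseqD mkseq_oconcat oshift_oconcat. Qed.

Lemma oconcat_mkseq w n : oconcat (mkseq w n) (oshift n w) = w.
Proof.
apply: funext => i; have [lt_in|le_ni] := ltnP i n.
  by rewrite (oconcat_lt _ (w 0%N)) ?size_mkseq // nth_mkseq.
by rewrite /oconcat size_mkseq ltnNge le_ni /= /oshift subnKC.
Qed.

Lemma oconcat_eq_prefix u v w w' : oconcat u w = oconcat v w' ->
  (size u <= size v)%N -> exists2 x, v = u ++ x & w = oconcat x w'.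
Proof.
move=> uw_vw' le_uv; exists (mkseq w (size v - size u)).
  by rewrite -mkseq_oconcat_add subnKC // uw_vw' mkseq_oconcat.
apply: (@oconcat_inj u).
by rewrite -oconcat_cat -mkseq_oconcat_add subnKC // uw_vw' mkseq_oconcat.
Qed.

Lemma occurs_at_cat w i u v :
  occurs_at w i (u ++ v) -> occurs_at w i u /\ occurs_at w (i + size u) v.
Proof.
rewrite /occurs_at size_cat /factor iotaD map_cat => /eqP.
by rewrite eqseq_cat ?size_factor // => /andP [/eqP ? /eqP ?].
Qed.

Lemma occurs_at_oconcat u w : occurs_at (oconcat u w) 0 u.
Proof. by rewrite /occurs_at -[LHS](mkseq_oconcat u w). Qed.

Lemma count_oconcat_ocst c (a : S) u v : a != c ->
  oconcat u (ocst c) = oconcat v (ocst c) -> count_mem a u = count_mem a v.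
Proof.
move=> aNc uc_vc; have := mkseq_oconcat_add u (ocst c) (size v).
rewrite uc_vc addnC mkseq_oconcat_add => /(congr1 (count_mem a)).
have aNocst n : count_mem a (mkseq (ocst c) n) = 0%N.
  by apply/count_memPn/mapP => -[i _ ac]; rewrite ac eqxx in aNc.
by rewrite !count_cat !aNocst !addn0.
Qed.

Lemma omega_pow_cons V y w : V y -> (0 < size y)%N -> omega_pow V w ->
  omega_pow V (oconcat y w).
Proof.
move=> Vy y_gt0 [b [b0 [b_incr bV]]].
exists (fun k => if k is k'.+1 then size y + b k' else 0)%N; split=> //.
split=> [[|k]|[|k]]; first by rewrite b0 addn0.
- by rewrite ltn_add2l.
- by rewrite b0 addn0 subn0 -/(mkseq _ _) mkseq_oconcat.
rewrite subnDl -/(factor _ _ _) -factor_oshift oshift_oconcat; exact: bV.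
Qed.

Lemma omega_pow_uncons V w : omega_pow V w ->
  exists y w', [/\ V y, (0 < size y)%N, w = oconcat y w' & omega_pow V w'].
Proof.
move=> [b [b0 [b_incr bV]]].
have le_b1 k : (b 1%N <= b k.+1)%N.
  by elim: k => // k IHk; apply: leq_trans IHk (ltnW (b_incr _)).
exists (mkseq w (b 1%N)), (oshift (b 1%N) w); split.
- by have := bV 0%N; rewrite b0 subn0.
- by rewrite size_mkseq -{1}b0.
- by rewrite oconcat_mkseq.
exists (fun k => b k.+1 - b 1%N)%N; split; first by rewrite subnn.
split=> k; first by rewrite ltn_sub2r // (leq_ltn_trans (le_b1 k)).
rewrite -/(factor _ _ _) factor_oshift subnKC // subnBA // subnK //; exact: bV.
Qed.

Lemma lconcatP U (L : olang S) w :
  lconcat U L w <-> exists u w', [/\ U u, L w' & w = oconcat u w'].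
Proof.
split=> [[u [w' [Uu [Lw' w_uw']]]]|[u [w' [Uu Lw' ->]]]]; exists u, w' => //.
by split=> //; apply: funext.
Qed.

Lemma omega_pow_letter c w : omega_pow (eq [:: c]) w <-> w = ocst c.
Proof.
split=> [[b [b0 [b_incr bc]]]|->]; last first.
  by exists id; split=> //; split=> // k; rewrite subSnn.
have b_id k : b k = k.
  elim: k => // k IHk; have := congr1 size (bc k).
  rewrite size_factor /= => /esym b_step.
  by rewrite -(subnKC (ltnW (b_incr k))) b_step IHk addn1.
by apply: funext => i; have := bc i; rewrite !b_id subSnn => -[].
Qed.

Lemma lconcat_letter U c w :
  lconcat U (omega_pow (eq [:: c])) w <-> exists2 u, U u & w = oconcat u (ocst c).
Proof.
split=> [/lconcatP [u [_ [Uu /omega_pow_letter -> ->]]]|[u Uu ->]].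
  by exists u.
by apply/lconcatP; exists u, (ocst c); split=> //; apply/omega_pow_letter.
Qed.

Inductive lconcat_star U V : lang S :=
| lconcat_star_nil x : U x -> lconcat_star U V x
| lconcat_star_cat x y :
    lconcat_star U V x -> V y -> (0 < size y)%N -> lconcat_star U V (x ++ y).

Lemma lconcat_star_omega_pow U V x w : lconcat_star U V x -> omega_pow V w ->
  lconcat U (omega_pow V) (oconcat x w).
Proof.
move=> UVx; elim: UVx w => {x} [x Ux|x y _ IHx Vy y_gt0] w Vw.
  by apply/lconcatP; exists x, w.
by rewrite oconcat_cat; apply/IHx/omega_pow_cons.
Qed.

Lemma lconcat_star_cut U V x w n :
    lconcat_star U V x -> omega_pow V w -> (size x <= n)%N ->
  exists x' y w', [/\ lconcat_star U V x', V y, omega_pow V w',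
    oconcat x w = oconcat x' (oconcat y w')
    & (size x' <= n < size x' + size y)%N].
Proof.
have [m] := ubnP (n - size x); elim: m x w => // m IHm x w lt_m UVx Vw le_xn.
have [y [w' [Vy y_gt0 -> Vw']]] := omega_pow_uncons Vw.
have [lt_n|le_n] := ltnP n (size x + size y).
  by exists x, y, w'; split=> //; rewrite le_xn.
rewrite -oconcat_cat; apply: IHm => //; rewrite ?size_cat //; last first.
  exact: lconcat_star_cat.
by lia.
Qed.

End InfiniteWords.

(** * Omega-regular languages *)

Section LeftQuotients.
Variable S : finType.
Implicit Types (U V : lang S) (L : olang S).

Definition finite_index L : Prop :=
  exists (Q : finType) (h : seq S -> Q),
    forall u v, h u = h v -> forall w, L (oconcat u w) -> L (oconcat v w).

Lemma finite_index_lconcat U V : regular U -> regular V ->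
  finite_index (lconcat U (omega_pow V)).
Proof.
move=> [A AU] [B BV].
pose runA := foldl (dfa_trans A) (dfa_init A).
pose runB := foldl (dfa_trans B) (dfa_init B).
pose pending u q := exists x y, [/\ u = x ++ y, lconcat_star U V x & runB y = q].
exists (dfa_state A * {set dfa_state B})%type.
exists (fun u => (runA u, [set q | `[< pending u q >]])) => u v [runA_uv pend_uv] w.
move=> /lconcatP [x [w' [Ux Vw' uw_xw']]].
have [le_ux|lt_xu] := leqP (size u) (size x).
  have [t x_ut ->] := oconcat_eq_prefix uw_xw' le_ux.
  rewrite -oconcat_cat; apply/lconcatP; exists (v ++ t), w'; split=> //.
  apply/AU; move/AU: Ux.
  by rewrite x_ut /dfa_accepts !foldl_cat -/(runA u) -/(runA v) runA_uv.
have [x1 [y [w1 [UVx1 Vy Vw1 xw'_cut /andP [le_x1u lt_ux1y]]]]] :=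
  lconcat_star_cut (lconcat_star_nil V Ux) Vw' (ltnW lt_xu).
rewrite xw'_cut in uw_xw'.
have [s u_x1s yw1_sw] := oconcat_eq_prefix (esym uw_xw') le_x1u.
have [|t y_st w_tw1] := oconcat_eq_prefix (esym yw1_sw).
  by rewrite -(leq_add2l (size x1)) -size_cat -u_x1s ltnW.
have : runB s \in [set q | `[< pending u q >]].
  by rewrite inE; apply/asboolP; exists x1, s.
rewrite pend_uv inE => /asboolP [x2 [s' [v_x2s' UVx2 runB_ss']]].
rewrite w_tw1 v_x2s' -!oconcat_cat -catA.
apply: lconcat_star_omega_pow => //; apply: lconcat_star_cat => //.
  apply/BV; move/BV: Vy.
  by rewrite y_st /dfa_accepts !foldl_cat -/(runB s) -/(runB s') runB_ss'.
by move: lt_ux1y; rewrite u_x1s y_st !size_cat; lia.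
Qed.

Lemma finite_index_bigcup (n : nat) (L : nat -> olang S) :
  (forall i, (i < n)%N -> finite_index (L i)) ->
  finite_index (fun w => exists2 i, (i < n)%N & L i w).
Proof.
elim: n => [|n IHn] finL; first by exists unit, (fun=> tt) => u v _ w [].
have [i lt_in|Q1 [h1 h1P]] := IHn; first exact/finL/leqW.
have [Q2 [h2 h2P]] := finL n (ltnSn n).
exists (Q1 * Q2)%type, (fun u => (h1 u, h2 u)) => u v [h1_uv h2_uv] w [j].
rewrite ltnS leq_eqVlt => /predU1P [->|lt_jn] Ljw.
  by exists n => //; apply: h2P Ljw.
have [|i lt_in Liw] := h1P _ _ h1_uv w; first by exists j.
by exists i => //; apply: leqW.
Qed.

Lemma omega_regular_finite_index L : omega_regular L -> finite_index L.
Proof.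
move=> [n [U [V [regUV LE]]]].
have [|Q [h hP]] :=
    @finite_index_bigcup n (fun i => lconcat (U i) (omega_pow (V i))).
  by move=> i /regUV [regU regV]; apply: finite_index_lconcat.
by exists Q, h => u v /hP huv w /LE/huv/LE.
Qed.

Lemma pigeonhole (Q : finType) (h : nat -> Q) : exists i j, (i < j)%N /\ h i = h j.
Proof.
have /injectivePn [i [j i_neq_j hij]] :
    ~~ injectiveb (fun i : 'I_(#|Q|.+1) => h i).
  by apply/injectiveP => /leq_card; rewrite card_ord ltnn.
have [lt_ij|lt_ji|/val_inj eq_ij] := ltngtP i j.
- by exists i, j.
- by exists j, i.
- by rewrite eq_ij eqxx in i_neq_j.
Qed.

Lemma diagonal_not_omega_regular L (x y : nat -> seq S) (w : oword S) :
  (forall i j, L (oconcat (x i ++ y j) w) <-> i = j) -> ~ omega_regular L.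
Proof.
move=> LE /omega_regular_finite_index [Q [h hP]].
have [i [j [lt_ij hij]]] := pigeonhole (h \o x).
have := hP _ _ hij (oconcat (y i) w).
rewrite -!oconcat_cat => /(_ ((LE i i).2 erefl)) /LE eq_ji.
by rewrite eq_ji ltnn in lt_ij.
Qed.

End LeftQuotients.

Section RegularContextFree.
Variable S : finType.
Implicit Types (u v : seq S) (L : lang S).

Lemma prefix_rcons_nth v x u : prefix (rcons v x) u =
  prefix v u && (onth u (size v) == Some x).
Proof.
elim: v u => [|y v IHv] [|z u] //=; last by rewrite IHv andbA.
by rewrite prefix0s andbT eq_sym.
Qed.

Lemma regular_word u : regular (eq u).
Proof.
pose state := option 'I_(size u).+1.
pose next (q : state) x : state :=
  if q isn't Some n then None else
  if onth u n == Some x then Some (inord n.+1) else None.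
pose A := @DFA S state (Some (inord 0)) next (pred1 (Some ord_max)).
exists A => v.
have runE : foldl (dfa_trans A) (dfa_init A) v =
    if prefix v u then Some (inord (size v)) else None.
  elim/last_ind: v => [|v x IHv]; first by rewrite prefix0s.
  rewrite foldl_rcons {}IHv prefix_rcons_nth size_rcons.
  case: ifP => //= /size_prefix le_vu.
  by rewrite inordK.
rewrite /dfa_accepts runE /=; split=> [<-|].
  by rewrite prefix_refl; apply/eqP; congr Some; apply: val_inj; rewrite /= inordK.
case: ifP => // /prefixP [t u_vt] /eqP [] /(congr1 val).
rewrite /= inordK u_vt size_cat ?ltnS ?leq_addr // => /esym/eqP.
by rewrite -[X in _ == X]addn0 eqn_add2l size_eq0 => /eqP ->; rewrite cats0.
Qed.

Lemma gen_inv (G : cfg S) (X : cfg_nt G) u : gen X u ->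
  exists2 r, (X, r) \in cfg_rules G & gens r u.
Proof. by case=> {}X r {}u Xr ru; exists r. Qed.

Lemma gens_inv (G : cfg S) (r : seq (cfg_nt G + S)) w : gens r w ->
  match r with
  | [::] => w = [::]
  | inr x :: r' => exists2 w', w = x :: w' & gens r' w'
  | inl Y :: r' => exists u v, [/\ w = u ++ v, gen Y u & gens r' v]
  end.
Proof.
by case=> [|x {}r {}w rw|Y {}r u v Yu rv] //; [exists w | exists u, v].
Qed.

Lemma regular_context_free L : regular L -> context_free L.
Proof.
move=> [A AL].
pose step_rule q a : dfa_state A * seq (dfa_state A + S) :=
  (q, [:: inr a; inl (dfa_trans A q a)]).
pose rules := [seq step_rule q a | q <- enum (dfa_state A), a <- enum S] ++
  [seq (q, [::]) | q <- enum (dfa_state A) & dfa_final A q].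
pose G := CFG (dfa_init A) rules; exists G => u.
suff genE q : @gen S G q u <-> dfa_final A (foldl (dfa_trans A) q u).
  by split=> [/AL/genE|/genE/AL].
elim: u q => [|a u IHu] q /=; split.
- move=> /gen_inv [r]; rewrite mem_cat => /orP [/allpairsP [[q' b] [_ _ [_ ->]]]|].
    by move=> /gens_inv [].
  by move=> /mapP [q']; rewrite mem_filter => /andP [final_q' _] [-> _] _.
- move=> final_q; apply: gen_rule (gens_nil _); rewrite mem_cat; apply/orP; right.
  by apply/mapP; exists q; rewrite // mem_filter final_q mem_enum.
- move=> /gen_inv [r]; rewrite mem_cat.
  move=> /orP [/allpairsP [[q' b] [_ _ [<- ->]]]|]; last first.
    by move=> /mapP [q' _ [_ ->]] /gens_inv.
  move=> /gens_inv [v [<- <-]] /gens_inv [u1 [u2 [u_eq gen_u1 /gens_inv u2_nil]]].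
  by move: gen_u1; rewrite u2_nil cats0 in u_eq; rewrite -u_eq => /IHu.
- move=> /IHu genu; apply: (@gen_rule S G q (step_rule q a).2).
    rewrite mem_cat; apply/orP; left.
    by apply/allpairsP; exists (q, a); rewrite !mem_enum.
  by apply: gens_t; rewrite -[u]cats0; apply: gens_nt genu (gens_nil _).
Qed.

Lemma context_free_anbn (a b : S) :
  context_free (fun u => exists n, u = nseq n a ++ nseq n b).
Proof.
set rules := [:: (tt, [::]); (tt, [:: inr a; inl tt; inr b])].
exists (@CFG S unit tt rules) => u; split=> [[n ->]|].
  elim: n => [|n IHn].
    by apply: gen_rule; [exact: mem_head | exact: gens_nil].
  apply: gen_rule; first by rewrite inE; apply/orP; right; exact: mem_head.
  rewrite -[X in _ ++ nseq X b]addn1 nseqD.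
  apply: gens_t; rewrite -/(nseq n a) -/cat catA; apply: gens_nt; first exact: IHn.
  by apply: gens_t; exact: gens_nil.
have [n] := ubnP (size u); elim: n u => // n IHn u lt_un genu.
have [r] := gen_inv genu; rewrite !inE => /orP [] /eqP [->].
  by move/gens_inv => ->; exists 0%N.
move=> /gens_inv [vb uE /gens_inv [v [b1 [vbE genv /gens_inv [t bE /gens_inv tE]]]]].
rewrite {}uE {}vbE {}bE {}tE in lt_un *.
have [|m ->] := IHn v _ genv; first by move: lt_un; rewrite /= size_cat /=; lia.
by exists m.+1; rewrite -catA -[X in _ = _ ++ nseq X _]addn1 nseqD.
Qed.

(* Both omega_regular and omega_cf are instances of omega_kleene. *)
Definition omega_kleene (P : lang S -> Prop) (M : olang S) : Prop :=
  exists (n : nat) (U V : nat -> lang S),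
    (forall i, (i < n)%N -> P (U i) /\ P (V i)) /\
    forall w, M w <-> exists2 i, (i < n)%N & lconcat (U i) (omega_pow (V i)) w.

Lemma omega_kleene_lconcat (P : lang S -> Prop) U V :
  P U -> P V -> omega_kleene P (lconcat U (omega_pow V)).
Proof.
move=> PU PV; exists 1%N, (fun=> U), (fun=> V); split=> // w.
by split=> [UVw|[]//]; exists 0%N.
Qed.

Lemma omega_regular_omega_cf (M : olang S) : omega_regular M -> omega_cf M.
Proof.
move=> [n [U [V [regUV ME]]]]; exists n, U, V; split=> // i /regUV [regU regV].
by split; apply: regular_context_free.
Qed.

End RegularContextFree.

(** * Balanced words and omega-context-free languages *)

Section BalancedWords.
Variable k : nat.
Implicit Types (u : seq (option 'I_k)).

Definition balanced u : Prop :=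
  forall i j : 'I_k, count_mem (Some i) u = count_mem (Some j) u.

(* blocks n spells a_0^n ... a_(k-1)^n c^omega, where a_i is Some i and c is None. *)
Definition blocks (n : nat) : oword (option 'I_k) := fun p => insub (p %/ n)%N.

Lemma blocks_eq n p (j : 'I_k) : (0 < n)%N ->
  (blocks n p == Some j) = (j * n <= p < j * n + n)%N.
Proof.
move=> n_gt0; have -> : (blocks n p == Some j) = (p %/ n == j)%N.
  rewrite /blocks; case: insubP => [i _ <- //|]; rewrite -leqNgt => le_kp.
  by apply/esym/gtn_eqF/(leq_trans _ le_kp).
by rewrite eqn_leq -ltnS ltn_divLR // leq_divRL // mulSn addnC andbC.
Qed.

Lemma blocks_tail n p : (0 < n)%N -> (k * n <= p)%N -> blocks n p = None.
Proof. by move=> n_gt0 le_p; rewrite /blocks insubN // -leqNgt leq_divRL. Qed.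

Lemma blocks_letter n p : (p < k * n)%N -> exists j : 'I_k, blocks n p = Some j.
Proof.
case: n => [|n]; first by rewrite muln0.
by rewrite -ltn_divLR // => lt_pk; exists (Ordinal lt_pk); rewrite /blocks insubT.
Qed.

Lemma oshift_blocks n m : (0 < n)%N -> (k * n <= m)%N ->
  oshift m (blocks n) = ocst None.
Proof.
move=> n_gt0 le_m; apply: funext => p.
by rewrite /oshift blocks_tail // (leq_trans le_m) ?leq_addr.
Qed.

Lemma count_whole_block n i u (j : 'I_k) : (0 < n)%N -> occurs_at (blocks n) i u ->
  (i <= j * n)%N -> (j * n + n <= i + size u)%N -> count_mem (Some j) u = n.
Proof.
move=> n_gt0 ->; rewrite size_factor count_map.
under eq_count do rewrite /= blocks_eq //.
move: (size u) (j * n)%N => m p le_ip le_pm.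
have -> : m = ((p - i) + (n + (i + m - (p + n))))%N by lia.
have count0 l s : (l + s <= p)%N || (p + n <= l)%N ->
    count (fun q => p <= q < p + n)%N (iota l s) = 0%N.
  move=> out; apply/eqP; rewrite eqn0Ngt -has_count; apply/hasPn => q.
  by rewrite mem_iota; lia.
rewrite !iotaD !count_cat subnKC // (count0 i) ?subnKC ?leqnn //.
rewrite (count0 (p + n)%N) ?leqnn ?orbT // addn0 add0n.
rewrite -[RHS](size_iota p); apply/eqP; rewrite -all_count.
by apply/allP => q; rewrite mem_iota.
Qed.

Lemma count_spanned_block n i u (a b d : 'I_k) :
  (0 < n)%N -> (a < b < d)%N -> occurs_at (blocks n) i u ->
  Some a \in u -> Some d \in u -> count_mem (Some b) u = n.
Proof.
move=> n_gt0 /andP [lt_ab lt_bd] u_at a_u d_u.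
have pos_of (j : 'I_k) : Some j \in u ->
    exists2 p, (i <= p < i + size u)%N & (j * n <= p < j * n + n)%N.
  rewrite {1}u_at => /mapP [p]; rewrite mem_iota => p_u /esym/eqP.
  by rewrite blocks_eq //; exists p.
have [[p p_u p_a] [q q_u q_d]] := (pos_of a a_u, pos_of d d_u).
have := leq_mul lt_ab (leqnn n); have := leq_mul lt_bd (leqnn n).
by rewrite !mulSn => le_bd le_ab; apply: count_whole_block u_at _ _; lia.
Qed.

Lemma balanced_mem u (i j : 'I_k) : balanced u -> Some i \in u -> Some j \in u.
Proof. by move=> bal; rewrite -!has_pred1 !has_count (bal i j). Qed.

Lemma balanced_blocks n : (0 < n)%N -> balanced (mkseq (blocks n) (k * n)).
Proof.
move=> n_gt0 i j.
suff count_n l : count_mem (Some l) (mkseq (blocks n) (k * n)) = n.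
  by rewrite !count_n.
apply: (@count_whole_block n 0) => //; first by rewrite /occurs_at size_mkseq.
by rewrite size_mkseq addnC -mulSn leq_mul2r ltn_ord orbT.
Qed.

End BalancedWords.

Arguments blocks {k} n.

Section ShortDerivations.
Variables (S : finType) (G : cfg S).

Lemma gen_short_witness : exists M, forall (X : cfg_nt G) w, gen X w ->
  exists2 v, gen X v & (size v <= M)%N.
Proof.
have /fin_all_exists [f fP] (X : cfg_nt G) : exists v, forall w, gen X w -> gen X v.
  have [[v Xv]|X_empty] := pselect (exists v, gen X v); first by exists v.
  by exists [::] => w Xw; case: X_empty; exists w.
exists (\max_X size (f X)) => X w Xw; exists (f X); first exact: fP Xw.
exact: (leq_bigmax X).
Qed.

Lemma rule_size_bounded :
  exists N, forall X r, (X, r) \in cfg_rules G -> (size r <= N)%N.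
Proof.
exists (\max_(rule <- cfg_rules G) size rule.2) => X r Xr.
have := @leq_bigmax_seq _ _ predT
  (fun rule : cfg_nt G * seq (cfg_nt G + S) => size rule.2) (X, r) Xr.
exact.
Qed.

End ShortDerivations.

Scheme gen_mut_ind := Minimality for gen Sort Prop
  with gens_mut_ind := Minimality for gens Sort Prop.

Section BalancedContext.
Variables (k : nat) (a b d : 'I_k).
Hypothesis lt_abd : (a < b < d)%N.
Implicit Types (K : lang (option 'I_k)) (u v : seq (option 'I_k)).

Definition balanceable K : Prop :=
  exists p q, forall u, K u -> balanced (p ++ u ++ q).

Lemma balanceable_imbalance K M u v (i j : 'I_k) : balanceable K ->
  K u -> (size u <= M)%N -> K v ->
  (count_mem (Some i) v <= count_mem (Some j) v + M)%N.
Proof.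
move=> [p [q pq_bal]] /pq_bal/(_ i j) + le_uM /pq_bal/(_ i j); rewrite !count_cat.
by have := leq_trans (count_size (pred1 (Some i)) u) le_uM; lia.
Qed.

Lemma count_le_or_whole_block n i u M : (0 < n)%N -> occurs_at (blocks n) i u ->
    (forall x y : 'I_k, count_mem (Some x) u <= count_mem (Some y) u + M)%N ->
  (count_mem (Some b) u <= M)%N \/ count_mem (Some b) u = n.
Proof.
move=> n_gt0 u_at le_imb.
have [a_u|/count_memPn a_u] := boolP (Some a \in u); last first.
  by left; have := le_imb b a; rewrite a_u.
have [d_u|/count_memPn d_u] := boolP (Some d \in u); last first.
  by left; have := le_imb b d; rewrite d_u.
by right; apply: count_spanned_block lt_abd u_at a_u d_u.
Qed.

(* The words generated by a nonterminal in a balanced context have bounded imbalance,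
   so a factor of blocks n among them either has few letters b or contains the whole
   block of b.  Since rules have bounded length, no derivation step passes from subwords
   of the first kind to a word of the second. *)
Lemma count_gen_balanceable_le (G : cfg (option 'I_k)) M N n :
  (forall (X : cfg_nt G) w, gen X w -> exists2 v, gen X v & (size v <= M)%N) ->
  (forall X r, (X, r) \in cfg_rules G -> (size r <= N)%N) ->
  (N * M.+1 < n)%N ->
  forall (X : cfg_nt G) w, gen X w -> forall i, occurs_at (blocks n) i w ->
  balanceable (gen X) -> (count_mem (Some b) w <= M)%N.
Proof.
move=> short rules lt_n.
apply: (@gen_mut_ind _ G _ (fun r w => forall i, occurs_at (blocks n) i w ->
  balanceable (gens r) -> (count_mem (Some b) w <= size r * M.+1)%N)) => //.
- move=> X r w Xr rw IHw i w_at bal.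
  have Xw := gen_rule Xr rw; have [v Xv le_vM] := short _ _ Xw.
  have n_gt0 : (0 < n)%N by lia.
  have [//|count_n] := count_le_or_whole_block n_gt0 w_at
    (fun x y => balanceable_imbalance x y bal Xv le_vM Xw).
  suff : (count_mem (Some b) w <= N * M.+1)%N by rewrite count_n leqNgt lt_n.
  apply: leq_trans (leq_mul (rules _ _ Xr) (leqnn _)).
  apply: (IHw i w_at); have [p [q pq_bal]] := bal.
  by exists p, q => u ru; apply: pq_bal; apply: gen_rule Xr ru.
- move=> x r w rw IHw i xw_at [p [q pq_bal]].
  have [_ w_at] := @occurs_at_cat _ (blocks n) i [:: x] w xw_at.
  rewrite /= mulSn; apply: leq_add; first exact: leq_trans (leq_b1 _) _.
  apply: IHw w_at _; exists (p ++ [:: x]), q => u ru.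
  by rewrite -catA; apply: (pq_bal (x :: u)); apply: gens_t.
- move=> Y r u v Yu IHu rv IHv i uv_at [p [q pq_bal]].
  have [u_at v_at] := occurs_at_cat uv_at.
  rewrite count_cat /= mulSn; apply: leq_add.
    apply/leqW/(IHu _ u_at); exists p, (v ++ q) => u' Yu'.
    by rewrite [u' ++ _]catA; apply: pq_bal; apply: gens_nt.
  apply: (IHv _ v_at); exists (p ++ u), q => v' rv'.
  by rewrite -catA [u ++ _]catA; apply: pq_bal; apply: gens_nt.
Qed.

Definition misses_block K T : Prop := (forall u, K u -> balanced u) ->
  forall n i u, (T < n)%N -> K u -> occurs_at (blocks n) i u ->
  count_mem (Some b) u <> n.

Lemma misses_block_leq K T T' :
  (T <= T')%N -> misses_block K T -> misses_block K T'.
Proof. by move=> le_T KT /KT missK n i u lt_T; apply/missK/(leq_ltn_trans le_T). Qed.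

Lemma context_free_misses_block K : context_free K -> exists T, misses_block K T.
Proof.
move=> [G KG].
have [[M short] [N rules]] := (gen_short_witness G, rule_size_bounded G).
exists (N * M.+1 + M)%N => balK n i u lt_n /KG genu u_at count_n.
have : (count_mem (Some b) u <= M)%N; last by lia.
apply: (count_gen_balanceable_le short rules _ genu u_at); first by lia.
by exists [::], [::] => v /KG /balK; rewrite cats0.
Qed.

Section OmegaIteration.
Variables (L : olang (option 'I_k)) (U V : lang (option 'I_k)).
Hypothesis L_balanced : forall u, L (oconcat u (ocst None)) <-> balanced u.
Hypothesis UV_L : forall w, lconcat U (omega_pow V) w -> L w.

Lemma balanced_head u : omega_pow V (ocst None) -> U u -> balanced u.
Proof.
by move=> Vc Uu; apply/L_balanced/UV_L/lconcatP; exists u, (ocst None).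
Qed.

Lemma balanced_loop x t u :
  U x -> omega_pow V (oconcat t (ocst None)) -> V u -> balanced u.
Proof.
move=> Ux Vt; case: u => // s u Vu i j.
have bal y : lconcat_star U V y -> balanced (y ++ t).
  move=> UVy; apply/L_balanced/UV_L; rewrite oconcat_cat.
  exact: lconcat_star_omega_pow.
have := bal x (lconcat_star_nil V Ux) i j.
have := bal _ (lconcat_star_cat (lconcat_star_nil V Ux) Vu isT) i j.
by rewrite !count_cat; lia.
Qed.

Lemma blocks_not_long_head T n x w : (T < n)%N -> misses_block U T ->
  U x -> omega_pow V w -> (k * n <= size x)%N -> blocks n <> oconcat x w.
Proof.
move=> lt_Tn missU Ux Vw le_x blocks_xw.
have n_gt0 : (0 < n)%N by apply: leq_ltn_trans lt_Tn.
have w_c : w = ocst None by rewrite -(oshift_oconcat x w) -blocks_xw oshift_blocks.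
have x_at : occurs_at (blocks n) 0 x by rewrite blocks_xw; apply: occurs_at_oconcat.
apply: (missU _ n 0%N x) => // [u|]; first by rewrite w_c in Vw; apply: balanced_head.
apply: count_whole_block x_at _ _ => //; rewrite add0n addnC -mulSn.
by apply: leq_trans le_x; rewrite leq_mul2r ltn_ord orbT.
Qed.

Lemma blocks_not_short_head T n x w : (T < n)%N -> misses_block V T ->
  U x -> omega_pow V w -> (size x < k * n)%N -> blocks n <> oconcat x w.
Proof.
move=> lt_Tn missV Ux Vw lt_x blocks_xw.
have n_gt0 : (0 < n)%N by apply: leq_ltn_trans lt_Tn.
have [y [w' [Vy y_gt0 w_yw' Vw']]] := omega_pow_uncons Vw.
rewrite w_yw' -oconcat_cat in blocks_xw.
have w'_tail : w' = oconcat (mkseq w' (k * n)) (ocst None).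
  rewrite -[LHS](oconcat_mkseq w' (k * n)) -[X in oshift _ X](oshift_oconcat (x ++ y)).
  by rewrite -oshiftD -blocks_xw oshift_blocks ?leq_addl.
have balV u : V u -> balanced u.
  by rewrite w'_tail in Vw'; apply: balanced_loop Ux Vw'.
have y_at : occurs_at (blocks n) (size x) y.
  have /occurs_at_cat [_] := occurs_at_oconcat (x ++ y) w'.
  by rewrite -blocks_xw.
apply: (missV balV n (size x) y) => //.
have [j x_j] := blocks_letter lt_x.
have j_y : Some j \in y.
  by rewrite y_at -x_j map_f // mem_iota leqnn -addn1 leq_add2l.
have mem_y l : Some l \in y by apply: balanced_mem (balV y Vy) j_y.
exact: count_spanned_block lt_abd y_at (mem_y a) (mem_y d).
Qed.

End OmegaIteration.

Lemma balanced_not_omega_cf (L : olang (option 'I_k)) :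
  (forall u, L (oconcat u (ocst None)) <-> balanced u) -> ~ omega_cf L.
Proof.
move=> L_balanced [n [U [V [cfUV LE]]]].
have /fin_all_exists [T missT] (i : 'I_n) :
    exists T, misses_block (U i) T /\ misses_block (V i) T.
  have [cfU cfV] := cfUV i (ltn_ord i).
  have [T1 miss1] := context_free_misses_block cfU.
  have [T2 miss2] := context_free_misses_block cfV.
  by exists (maxn T1 T2); split; [apply: misses_block_leq miss1 |
    apply: misses_block_leq miss2]; rewrite ?leq_maxl ?leq_maxr.
pose m := (\max_i T i).+1.
have /LE [i lt_in /lconcatP [x [w [Ux Vw blocks_xw]]]] : L (blocks m).
  rewrite -(oconcat_mkseq (blocks m) (k * m)) oshift_blocks //.
  exact/L_balanced/balanced_blocks.
have [missU missV] := missT (Ordinal lt_in).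
have lt_Tm : (T (Ordinal lt_in) < m)%N by exact: (leq_bigmax (Ordinal lt_in)).
have UV_L w' : lconcat (U i) (omega_pow (V i)) w' -> L w'.
  by move=> UVw'; apply/LE; exists i.
have [le_x|lt_x] := leqP (k * m) (size x).
  exact: (blocks_not_long_head L_balanced UV_L lt_Tm missU Ux Vw le_x).
exact: (blocks_not_short_head L_balanced UV_L lt_Tm missV Ux Vw lt_x).
Qed.

End BalancedContext.

(** * Finite-dimensional Hilbert spaces *)

Section SquaredModulus.
Implicit Types (z t : C).

Lemma sqmodC z : (sqmod z)%:C%C = `|z| ^+ 2.
Proof. exact: add_Re2_Im2. Qed.

Lemma sqmod_ge0 z : 0 <= sqmod z.
Proof. by rewrite addr_ge0 ?sqr_ge0. Qed.

Lemma sqmod1 : sqmod 1 = 1.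
Proof. by rewrite /sqmod /= expr1n expr0n addr0. Qed.

Lemma sqmodM z t : sqmod (z * t) = sqmod z * sqmod t.
Proof. by apply: complexI; rewrite rmorphM /= !sqmodC normrM exprMn. Qed.

Lemma sqmodX_unit z n : sqmod z = 1 -> sqmod (z ^+ n) = 1.
Proof.
by move=> z1; elim: n => [|n IHn]; rewrite ?sqmod1 // exprS sqmodM z1 IHn mulr1.
Qed.

Lemma sqmodR (x : R) : sqmod x%:C%C = x ^+ 2.
Proof. by rewrite /sqmod /= expr0n addr0. Qed.

Lemma sqmod_conjc z : sqmod (conjc z) = sqmod z.
Proof. by case: z => x y; rewrite /sqmod /= sqrrN. Qed.

Lemma conjcM z t : conjc (z * t) = conjc z * conjc t.
Proof. exact: rmorphM. Qed.

Lemma conjc_mul z : conjc z * z = (sqmod z)%:C%C.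
Proof. by rewrite sqmodC sqr_normc mulrC. Qed.

Lemma sqmodD z t :
  sqmod (z + t) = sqmod z + sqmod t + 2 * complex.Re (conjc z * t).
Proof. by case: z t => [x y] [x' y']; rewrite /sqmod /=; ring. Qed.

Lemma sqmodD_ge z t (r : R) : sqmod z <= 1 -> sqmod t <= r ^+ 2 -> 0 <= r ->
  sqmod z - 2 * r <= sqmod (z + t).
Proof.
move=> z_le1 t_le r_ge0.
have Re2_le : complex.Re (conjc z * t) ^+ 2 <= r ^+ 2.
  have : sqmod (conjc z * t) <= r ^+ 2.
    rewrite sqmodM sqmod_conjc -[leRHS]mul1r.
    by rewrite ler_pM ?sqmod_ge0.
  by apply: le_trans; rewrite lerDl sqr_ge0.
have : - r <= complex.Re (conjc z * t).
  rewrite lerNl; apply: le_trans (ler_norm _) _.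
  by rewrite normrN -[leRHS]ger0_norm // -ler_sqr ?nnegrE // !real_normK ?num_real.
by have := sqmod_ge0 t; rewrite sqmodD; lra.
Qed.

Lemma sqmod_sum_unit (I : finType) (z : I -> C) : (forall i, sqmod (z i) = 1) ->
  sqmod (\sum_i z i) = #|I|%:R ^+ 2 <-> forall i j, z i = z j.
Proof.
move=> z_unit.
have norm_z i : `|z i| = 1.
  by apply/eqP; rewrite -sqrp_eq1 // -sqmodC z_unit.
have sum_norm : \sum_i `|z i| = #|I|%:R by rewrite (eq_bigr (fun=> 1)) ?sumr_const.
have sqmod_norm : sqmod (\sum_i z i) = #|I|%:R ^+ 2 <-> `|\sum_i z i| = #|I|%:R.
  split=> [/(congr1 (real_complex R))|sum_z].
    by rewrite /= sqmodC rmorphXn rmorph_nat => /eqP; rewrite eqrXn2 // => /eqP.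
  by apply: complexI; rewrite /= sqmodC sum_z rmorphXn rmorph_nat.
split=> [/sqmod_norm|z_cst]; last apply/sqmod_norm.
  by rewrite -sum_norm => /normC_sum_eq1 [//|t _ z_t] i j; rewrite !z_t.
have [i _|I0] := pickP I; last by rewrite big_pred0 // eq_card0 ?normr0.
by rewrite (eq_bigr (fun=> z i)) // sumr_const normrMn norm_z.
Qed.

End SquaredModulus.

Section HilbertSpace.
Variable d : nat.
Implicit Types (u v w : 'cV[C]_d) (M N : 'M[C]_d).

Definition norm2 v : R := \sum_i sqmod (v i 0).

Lemma dotc_norm2 v : dotc v v = (norm2 v)%:C%C.
Proof.
by rewrite /dotc /norm2 rmorph_sum; apply: eq_bigr => i _; rewrite conjc_mul.
Qed.

Lemma dotc_unit v : dotc v v = 1 <-> norm2 v = 1.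
Proof. by rewrite dotc_norm2; split=> [[] | ->]. Qed.

Lemma norm2Z z v : norm2 (z *: v) = sqmod z * norm2 v.
Proof. by rewrite /norm2 mulr_sumr; apply: eq_bigr => i _; rewrite mxE sqmodM. Qed.

Lemma dotcE u v : dotc u v = ((map_mx conjc u)^T *m v) 0 0.
Proof. by rewrite mxE; apply: eq_bigr => i _; rewrite !mxE. Qed.

Lemma dotcDr u v w : dotc u (v + w) = dotc u v + dotc u w.
Proof. by rewrite !dotcE mulmxDr mxE. Qed.

Lemma dotcZl z u v : dotc (z *: u) v = conjc z * dotc u v.
Proof.
by rewrite /dotc mulr_sumr; apply: eq_bigr => i _; rewrite mxE conjcM mulrA.
Qed.

Lemma sqmod_dotc_le u v : sqmod (dotc u v) <= norm2 u * norm2 v.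
Proof.
have dotc_dotmx x y : dotc x y = dotmx y^T x^T.
  by rewrite dotmxE mxE; apply: eq_bigr => i _; rewrite !mxE mulrC.
rewrite -lecR sqmodC rmorphM /= -!dotc_norm2 !dotc_dotmx mulrC.
by have [CS _] := CauchySchwarz (@dotmx C d) v^T u^T; apply: CS.
Qed.

Lemma unitary1 : unitary (1%:M : 'M[C]_d).
Proof. by rewrite /unitary /adjmx trmx1 map_mx1 mulmx1. Qed.

Lemma unitaryM M N : unitary M -> unitary N -> unitary (M *m N).
Proof.
rewrite /unitary /adjmx => uM uN; rewrite trmx_mul map_mxM mulmxA.
by rewrite -(mulmxA _ (map_mx _ _)) uM mulmx1.
Qed.

Lemma unitaryX M n : unitary M -> unitary (M ^+ n).
Proof.
move=> uM; elim: n => [|n IHn]; first exact: unitary1.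
by rewrite exprS; apply: unitaryM.
Qed.

Lemma norm2_unitary M v : unitary M -> norm2 (M *m v) = norm2 v.
Proof.
move=> uM; apply: complexI; rewrite -!dotc_norm2 !dotcE.
rewrite map_mxM trmx_mul mulmxA -(mulmxA _ _ M) [X in _ *m (X *m M)]map_trmx.
by rewrite -/(adjmx M) uM mulmx1.
Qed.

End HilbertSpace.

(** * Recurrence *)

Section Recurrence.
Variable Q : finType.

Lemma pigeonhole_close (F : archiRealFieldType) (I : finType) (h : nat -> Q)
    (g : nat -> I -> F) (e : F) :
    0 < e -> (forall n l, `|g n l| <= 1) ->
  exists i j, [/\ (i < j)%N, h i = h j & forall l, `|g i l - g j l| < e].
Proof.
move=> e_gt0 g_le1; pose N := (Num.truncn e^-1).+1.
have N_gt0 : 0 < N%:R :> F by rewrite ltr0n.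
have Ne_gt1 : 1 < N%:R * e by rewrite -ltr_pdivrMr // mul1r truncnS_gt.
pose cell n l := Num.truncn ((g n l + 1) * N%:R).
have cell_itv n l : (cell n l)%:R <= (g n l + 1) * N%:R < (cell n l).+1%:R.
  apply: truncn_itv; apply: mulr_ge0; last exact: ltW.
  by have := g_le1 n l; rewrite ler_norml => /andP []; lra.
have cell_le n l : (cell n l < (2 * N).+1)%N.
  rewrite ltnS -(ler_nat F) natrM.
  have /andP [le_cell _] := cell_itv n l; apply: le_trans le_cell _.
  by rewrite ler_pM2r //; have := g_le1 n l; rewrite ler_norml => /andP []; lra.
have [i [j [lt_ij [hij /ffunP cell_ij]]]] :=
  pigeonhole (fun n => (h n, [ffun l => Ordinal (cell_le n l)])).
exists i, j; split=> // l; have := cell_ij l; rewrite !ffunE => -[cell_l].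
have := cell_itv i l; have := cell_itv j l; rewrite cell_l -natr1 => itv_j itv_i.
rewrite -(ltr_pM2l N_gt0); apply: lt_trans Ne_gt1.
by rewrite -[X in X * `|_|]gtr0_norm // -normrM ltr_norml; lra.
Qed.

Lemma pigeonhole_norm2 (d : nat) (h : nat -> Q) (s : nat -> 'cV[C]_d) (r : R) :
    0 < r -> (forall n, norm2 (s n) <= 1) ->
  exists i j, [/\ (i < j)%N, h i = h j & norm2 (s j - s i) < r].
Proof.
move=> r_gt0 s_le1.
pose g n (l : 'I_d * bool) : R :=
  if l.2 then complex.Re (s n l.1 0) else complex.Im (s n l.1 0).
have g_le1 n l : `|g n l| <= 1.
  rewrite -(ler_pXn2r (n := 2)) ?nnegrE //= expr1n real_normK ?num_real //.
  apply: le_trans (s_le1 n); rewrite /norm2 (bigD1 l.1) //= -[leLHS]addr0 lerD //.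
    by rewrite /g /sqmod; case: l.2; rewrite ?lerDl ?lerDr sqr_ge0.
  by apply: sumr_ge0 => i _; apply: sqmod_ge0.
have d_ge0 : 0 <= d%:R :> R by [].
pose e : R := Num.min 1 (r / (2 * d%:R + 1)).
have e_gt0 : 0 < e by rewrite lt_min ltr01 divr_gt0 //; lra.
have e_le1 : e <= 1 by rewrite ge_min lexx.
have e_small : 2 * d%:R * e < r.
  have : e * (2 * d%:R + 1) <= r by rewrite -ler_pdivlMr ?ge_min ?lexx ?orbT //; lra.
  by nra.
have [i [j [lt_ij hij gij]]] := pigeonhole_close h e_gt0 g_le1.
exists i, j; split=> //; apply: le_lt_trans e_small.
have -> : 2 * d%:R * e = \sum_(l < d) 2 * e.
  by rewrite sumr_const card_ord -mulr_natr; ring.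
apply: ler_sum => l _; rewrite !mxE.
have := gij (l, true); have := gij (l, false); rewrite /g /= /sqmod.
case: (s j l 0) => x y; case: (s i l 0) => x' y' /=; rewrite !ltr_norml.
by nra.
Qed.

End Recurrence.

Lemma unitary_recurrent d (M : 'M[C]_d) (v : 'cV[C]_d) (r : R) :
    unitary M -> norm2 v <= 1 -> 0 < r ->
  exists2 n, (0 < n)%N & norm2 (M ^+ n *m v - v) < r.
Proof.
move=> uM v_le1 r_gt0.
have [|i [j [lt_ij _ close_ij]]] :=
    @pigeonhole_norm2 _ _ (fun=> tt) (fun n => M ^+ n *m v) r r_gt0.
  by move=> n; rewrite norm2_unitary //; apply: unitaryX.
exists (j - i)%N; first by rewrite subn_gt0.
rewrite -(norm2_unitary _ (unitaryX i uM)) mulmxBr mulmxA.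
by rewrite [M ^+ i *m M ^+ _](esym (exprD M i _)) subnKC // ltnW.
Qed.

(** * Runs of quantum automata *)

Section Runs.
Variables (S : finType) (A : qa S).
Implicit Types (w : oword S) (u v : seq S).

Definition word_mx u : 'M[C]_(qa_dim A) := \prod_(a <- rev u) qa_U A a.

Lemma word_mx_rcons u a : word_mx (rcons u a) = qa_U A a *m word_mx u.
Proof. by rewrite /word_mx rev_rcons big_cons. Qed.

Lemma word_mx_cat u v : word_mx (u ++ v) = word_mx v *m word_mx u.
Proof. by rewrite /word_mx rev_cat big_cat. Qed.

Lemma word_mx_repeat u n : word_mx (flatten (nseq n u)) = word_mx u ^+ n.
Proof.
by elim: n => [|n IHn] /=; rewrite ?word_mx_cat ?IHn ?exprSr // /word_mx big_nil.
Qed.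

Lemma unitary_word_mx u : unitary (word_mx u).
Proof.
rewrite /word_mx; elim/big_ind: _ => [|M N uM uN|a _]; first exact: unitary1.
  exact: unitaryM.
exact: qa_U_unitary.
Qed.

Lemma qa_runE w n : qa_run A w n = word_mx (mkseq w n) *m qa_s0 A.
Proof.
elim: n => [|n IHn]; first by rewrite /word_mx big_nil mul1mx.
by rewrite mkseqS word_mx_rcons /= IHn mulmxA.
Qed.

Lemma qa_run_oconcat u w n : qa_run A (oconcat u w) (size u + n) =
  word_mx (mkseq w n) *m (word_mx u *m qa_s0 A).
Proof. by rewrite qa_runE mkseq_oconcat_add word_mx_cat mulmxA. Qed.

Lemma norm2_s0 : norm2 (qa_s0 A) = 1.
Proof. exact/dotc_unit/qa_s0_unit. Qed.

Lemma norm2_qa_run w n : norm2 (qa_run A w n) = 1.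
Proof. by rewrite qa_runE norm2_unitary ?norm2_s0 //; apply: unitary_word_mx. Qed.

Definition overlap w (psi : 'cV[C]_(qa_dim A)) n : R :=
  sqmod (dotc psi (qa_run A w n)).

Lemma overlap_ge0 w psi n : 0 <= overlap w psi n.
Proof. exact: sqmod_ge0. Qed.

Lemma overlap_le1 w psi n : norm2 psi = 1 -> overlap w psi n <= 1.
Proof.
move=> psi1; apply: le_trans (sqmod_dotc_le _ _) _.
by rewrite psi1 norm2_qa_run mul1r.
Qed.

Definition recurring_overlap w (x : R) psi (n : nat -> nat) : Prop :=
  [/\ in_subspace (qa_F A) psi, norm2 psi = 1, forall i, (n i < n i.+1)%N
    & forall i, x <= overlap w psi (n i)].

Definition ND_values w : set R := fun x =>
  exists psi : 'cV[C]_(qa_dim A),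
    in_subspace (qa_F A) psi /\ dotc psi psi = 1 /\
    exists n : nat -> nat, (forall i, (n i < n i.+1)%N) /\
      x = inf (fun y : R => exists i, y = overlap w psi (n i)).

Lemma f_NDE w : f_ND A w = sup (ND_values w).
Proof. by []. Qed.

Lemma inf_overlap_le w psi (n : nat -> nat) i :
  inf (fun y : R => exists i, y = overlap w psi (n i)) <= overlap w psi (n i).
Proof.
apply: ge_inf; last by exists i.
by exists 0 => _ [j ->]; apply: overlap_ge0.
Qed.

Lemma lt_f_ND lam w : 0 <= lam -> lam < f_ND A w ->
  exists x psi n, lam < x /\ recurring_overlap w x psi n.
Proof.
move=> lam_ge0; rewrite f_NDE => lam_lt.
have values_neq0 : (ND_values w !=set0)%classic.
  by apply/set0P/eqP => values0; rewrite values0 sup0 ltNge lam_ge0 in lam_lt.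
have [x [psi [F_psi [/dotc_unit psi1 [n [n_incr x_inf]]]]] lt_x] :=
  sup_gt values_neq0 lam_lt.
exists x, psi, n; split=> //; split=> // i.
by rewrite x_inf; apply: inf_overlap_le.
Qed.

Lemma le_f_ND w x psi n : recurring_overlap w x psi n -> x <= f_ND A w.
Proof.
move=> [F_psi psi1 n_incr le_x].
pose y := inf (fun y : R => exists i, y = overlap w psi (n i)).
have le_xy : x <= y.
  by apply: lb_le_inf => [|_ [i ->] //]; exists (overlap w psi (n 0%N)), 0%N.
apply: le_trans le_xy _; rewrite f_NDE; apply: ub_le_sup.
  exists 1 => _ [phi [_ [/dotc_unit phi1 [m [_ ->]]]]].
  by apply: le_trans (inf_overlap_le w phi m 0%N) (overlap_le1 _ _ phi1).
by exists psi; split=> //; split; [apply/dotc_unit | exists n].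
Qed.

(* Some power of the unitary of u almost fixes the initial state, and unitaries preserve
   this proximity along the whole run. *)
Lemma L_gt_prepend lam w u : 0 <= lam -> L_gt lam A w ->
  exists2 m, (0 < m)%N & L_gt lam A (oconcat (flatten (nseq m u)) w).
Proof.
move=> lam_ge0 /(lt_f_ND lam_ge0) [x [psi [n [lt_x [F_psi psi1 n_incr le_x]]]]].
pose r := (x - lam) / 4; have r_gt0 : 0 < r by rewrite /r; lra.
have s0_le1 : norm2 (qa_s0 A) <= 1 by rewrite norm2_s0.
have [m m_gt0 close_m] :=
  unitary_recurrent (unitary_word_mx u) s0_le1 (exprn_gt0 2 r_gt0).
exists m => //; set um := flatten _.
apply: (@lt_le_trans _ _ (x - 2 * r)); first by rewrite /r; lra.
apply: (@le_f_ND _ _ psi (fun i => size um + n i)%N); split=> // i.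
  by rewrite ltn_add2l.
have -> : overlap (oconcat um w) psi (size um + n i) =
    sqmod (dotc psi (qa_run A w (n i)) +
      dotc psi (word_mx (mkseq w (n i)) *m (word_mx um *m qa_s0 A - qa_s0 A))).
  by rewrite -dotcDr mulmxBr addrC -qa_runE subrK -qa_run_oconcat.
apply: le_trans (sqmodD_ge (overlap_le1 _ _ psi1) _ (ltW r_gt0)).
  by rewrite lerB ?le_x.
apply: le_trans (sqmod_dotc_le _ _) _; rewrite psi1 mul1r norm2_unitary.
  by rewrite word_mx_repeat ltW.
exact: unitary_word_mx.
Qed.

End Runs.

(* If c acts as the identity then the run on u c^omega is eventually constant. *)
Lemma f_ND_idle_letter (S : finType) (A : qa S) c (psi : 'cV[C]_(qa_dim A)) u :
  qa_U A c = 1%:M -> norm2 psi = 1 ->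
  (forall phi, in_subspace (qa_F A) phi <-> exists z, phi = z *: psi) ->
  f_ND A (oconcat u (ocst c)) = sqmod (dotc psi (word_mx A u *m qa_s0 A)).
Proof.
move=> Uc psi1 F_psi; set w := oconcat _ _; set s := _ *m _.
have run_w n : qa_run A w (size u + n) = s.
  rewrite qa_run_oconcat; elim: n => [|n IHn].
    by rewrite /word_mx big_nil mul1mx.
  by rewrite mkseqS word_mx_rcons Uc mul1mx.
apply/eqP; rewrite eq_le; apply/andP; split; last first.
  apply: (@le_f_ND _ _ _ _ psi (fun i => size u + i)%N); split=> [|//|i|i].
  - by apply/F_psi; exists 1; rewrite scale1r.
  - by rewrite ltn_add2l.
  - by rewrite /overlap run_w.
rewrite leNgt; apply/negP => /(lt_f_ND (sqmod_ge0 _)).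
move=> [x [phi [n [lt_x [/F_psi [z ->] z_psi1 n_incr /(_ (size u)) le_x]]]]].
have le_n i : (i <= n i)%N by elim: i => // i IHi; apply: leq_ltn_trans (n_incr i).
have z1 : sqmod z = 1 by rewrite norm2Z psi1 mulr1 in z_psi1.
move: le_x; rewrite /overlap -(subnKC (le_n (size u))) run_w dotcZl sqmodM.
by rewrite sqmod_conjc z1 mul1r leNgt lt_x.
Qed.

Section DiagonalAutomaton.
Variables (S : finType) (d : nat) (phase : S -> 'I_d -> C) (s0 psi : 'cV[C]_d).
Hypothesis phase_unit : forall a i, sqmod (phase a i) = 1.
Hypotheses (s0_unit : norm2 s0 = 1) (psi_unit : norm2 psi = 1).

Lemma unitary_diag a : unitary (diag_mx (\row_i phase a i)).
Proof.
rewrite /unitary /adjmx tr_diag_mx map_diag_mx mulmx_diag -diag_const_mx.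
by congr diag_mx; apply/rowP => i; rewrite !mxE conjc_mul phase_unit.
Qed.

Definition diag_qa : qa S :=
  QA <<psi^T>>%MS ((dotc_unit s0).2 s0_unit) unitary_diag.

Lemma diag_qa_subspace phi :
  in_subspace (qa_F diag_qa) phi <-> exists z, phi = z *: psi.
Proof.
rewrite /in_subspace /= genmxE; split=> [/sub_rVP [z phi_z]|[z ->]].
  by exists z; rewrite -[phi]trmxK phi_z linearZ /= trmxK.
by rewrite linearZ scalemx_sub.
Qed.

Lemma word_mx_diag u : word_mx diag_qa u = diag_mx (\row_i \prod_(a <- u) phase a i).
Proof.
elim/last_ind: u => [|u a IHu].
  rewrite /word_mx big_nil -[RHS]/(diag_mx _) -[LHS]diag_const_mx.
  by congr diag_mx; apply/rowP => i; rewrite !mxE big_nil.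
rewrite word_mx_rcons IHu mulmx_diag; congr diag_mx; apply/rowP => i.
by rewrite !mxE big_rcons mulrC.
Qed.

Lemma f_ND_diag c u : (forall i, phase c i = 1) ->
  f_ND diag_qa (oconcat u (ocst c)) =
  sqmod (\sum_i conjc (psi i 0) * (\prod_(a <- u) phase a i * s0 i 0)).
Proof.
move=> phase_c; rewrite (@f_ND_idle_letter _ diag_qa c psi) //.
- congr sqmod; apply: eq_bigr => i _.
  by rewrite word_mx_diag mul_diag_mx !mxE.
- by rewrite /= -diag_const_mx; congr diag_mx; apply/rowP => i; rewrite !mxE.
- exact: diag_qa_subspace.
Qed.

End DiagonalAutomaton.

(** * The counting automaton *)

Section CountingAutomaton.
Variables (k : nat) (z : C).
Hypotheses (k_gt0 : (0 < k)%N) (z_unit : sqmod z = 1).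

Definition count_phase (x : option 'I_k) (i : 'I_k) : C :=
  if x == Some i then z else 1.

Definition uniform_state (kappa : 'I_k -> C) : 'cV[C]_k :=
  \col_i (kappa i * (Num.sqrt k%:R^-1 : R)%:C%C).

Lemma sqmod_count_phase x i : sqmod (count_phase x i) = 1.
Proof. by rewrite /count_phase; case: eqP; rewrite ?sqmod1. Qed.

Lemma norm2_uniform_state kappa :
  (forall i, sqmod (kappa i) = 1) -> norm2 (uniform_state kappa) = 1.
Proof.
move=> kappa_unit; have k_neq0 : k%:R != 0 :> R by rewrite pnatr_eq0 -lt0n.
rewrite /norm2 (eq_bigr (fun=> k%:R^-1)) => [|i _].
  by rewrite sumr_const card_ord -[LHS]mulr_natr mulVf.
by rewrite mxE sqmodM kappa_unit sqmodR sqr_sqrtr ?invr_ge0 ?mul1r.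
Qed.

Definition count_qa (kappa : 'I_k -> C) : qa (option 'I_k) :=
  diag_qa (uniform_state kappa) sqmod_count_phase
    (norm2_uniform_state (fun=> sqmod1)).

Lemma f_ND_count kappa u : (forall i, sqmod (kappa i) = 1) ->
  f_ND (count_qa kappa) (oconcat u (ocst None)) =
  sqmod (\sum_i conjc (kappa i) * z ^+ count_mem (Some i) u) / k%:R ^+ 2.
Proof.
move=> kappa_unit; rewrite f_ND_diag //; last exact: norm2_uniform_state.
have prod_phase i : \prod_(x <- u) count_phase x i = z ^+ count_mem (Some i) u.
  by rewrite /count_phase -big_mkcond big_const_seq -Monoid.iteropE.
rewrite -exprVn -sqmodR mulrC -sqmodM mulr_sumr.
congr sqmod; apply: eq_bigr => i _; rewrite !mxE prod_phase conjcM conjc_real.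
rewrite -[in RHS](sqr_sqrtr (a := k%:R^-1)) ?invr_ge0 // rmorphXn.
by ring.
Qed.

Hypothesis z_aperiodic : injective (fun n => z ^+ n).

Definition balance_qa : qa (option 'I_k) := count_qa (fun=> 1).

Lemma L_eq1_balance u : L_eq1 balance_qa (oconcat u (ocst None)) <-> balanced u.
Proof.
rewrite /L_eq1 f_ND_count => [|i]; last exact: sqmod1.
have k2_neq0 : k%:R ^+ 2 != 0 :> R by rewrite expf_neq0 // pnatr_eq0 -lt0n.
under eq_bigr do rewrite conjc1 mul1r.
have zX_unit (i : 'I_k) := sqmodX_unit (count_mem (Some i) u) z_unit.
have := sqmod_sum_unit zX_unit; rewrite card_ord => sum_unit.
split=> [/divr1_eq/sum_unit sum_eq i j|bal]; first exact/z_aperiodic/sum_eq.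
by rewrite (sum_unit.2 _) ?divff // => i j; rewrite (bal i j).
Qed.

Lemma balance_qa_not_omega_cf : (2 < k)%N -> ~ omega_cf (L_eq1 balance_qa).
Proof.
move=> lt_2k; have lt_1k := ltnW lt_2k.
exact: (@balanced_not_omega_cf k (Ordinal k_gt0) (Ordinal lt_1k) (Ordinal lt_2k)
  isT _ L_eq1_balance).
Qed.

End CountingAutomaton.

Section ThresholdLanguage.
Variables (z kappa : C).
Hypotheses (z_unit : sqmod z = 1) (z_aperiodic : injective (fun n => z ^+ n)).
Hypotheses (kappa_unit : sqmod kappa = 1) (kappa_Im : complex.Im kappa != 0).

Definition tilt (i : 'I_2) : C := if i == 0 then kappa else 1.

Definition threshold_qa : qa (option 'I_2) := @count_qa 2 z isT z_unit tilt.

Definition threshold_lang : olang (option 'I_2) :=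
  L_gt ((1 + complex.Re kappa) / 2) threshold_qa.

Definition ab_word (i j : nat) : seq (option 'I_2) :=
  nseq i (Some 0) ++ nseq j (Some 1).

Lemma threshold_langE i j :
  threshold_lang (oconcat (ab_word i j) (ocst None)) <->
  complex.Re kappa < complex.Re (kappa * (conjc (z ^+ i) * z ^+ j)).
Proof.
have tilt_unit l : sqmod (tilt l) = 1 by rewrite /tilt; case: eqP; rewrite ?sqmod1.
have zX_unit n := sqmodX_unit n z_unit.
have [tilt0 tilt1] : tilt ord0 = kappa /\ tilt (lift ord0 ord0) = 1 by [].
rewrite /threshold_lang /L_gt f_ND_count //.
rewrite big_ord_recl big_ord1 tilt0 tilt1 conjc1 mul1r.
rewrite /ab_word !count_cat !count_nseq /= !mul1n !mul0n addn0 add0n.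
rewrite sqmodD sqmodM sqmod_conjc kappa_unit !zX_unit conjcM conjcK -mulrA.
set x := complex.Re (_ * _).
have -> : (1 * 1 + 1 + 2 * x) / 2%:R ^+ 2 = (1 + x) / 2 :> R by field.
by rewrite ltr_pM2r ?invr_gt0 // ltrD2l.
Qed.

(* One of the two rotations gains |Im kappa * Im e|, of first order in the angle of e; both
   lose Re kappa * (1 - Re e), which is only of second order. *)
Lemma small_rotation_increases_Re (e : C) :
  sqmod e = 1 -> e != 1 -> sqmod (e - 1) < complex.Im kappa ^+ 2 ->
  complex.Re kappa < complex.Re (kappa * e) \/
  complex.Re kappa < complex.Re (kappa * conjc e).
Proof.
move: kappa_unit kappa_Im; case: kappa e => [p q] [x y]; rewrite /sqmod eq_complex /=.
rewrite subr0 => pq1 q_neq0 xy1 e_neq1 close_e.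
have q2_le1 : q ^+ 2 <= 1 by have := sqr_ge0 p; lra.
have x_gt0 : 0 < x by have := sqr_ge0 y; nra.
have y_neq0 : y != 0.
  apply: contra e_neq1 => /eqP y0; rewrite y0 eqxx andbT.
  by rewrite -sqrp_eq1 ?ltW // -xy1 y0 expr0n addr0.
have loss_le : p * (1 - x) <= y ^+ 2.
  have p_le1 : p <= 1 by have := sqr_ge0 q; nra.
  by have := sqr_ge0 y; nra.
have lt_gain : y ^+ 2 < `|q * y|.
  rewrite -real_normK ?num_real // normrM expr2 ltr_pM2r ?normr_gt0 //.
  rewrite -ltr_sqr ?nnegrE // !real_normK ?num_real //.
  by have := sqr_ge0 (x - 1); lra.
have [qy_ge0|qy_lt0] := ger0P (q * y).
  by right; move: lt_gain; rewrite ger0_norm //; lra.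
by left; move: lt_gain; rewrite ltr0_norm //; lra.
Qed.

Lemma threshold_lang_not_omega_regular : ~ omega_regular threshold_lang.
Proof.
move=> /omega_regular_finite_index [Q [h hP]].
have zX_unit n := sqmodX_unit n z_unit.
have norm2_1 (t : C) : norm2 (const_mx t : 'cV_1) = sqmod t.
  by rewrite /norm2 big_ord1 mxE.
have Im2_gt0 : 0 < complex.Im kappa ^+ 2 by rewrite exprn_even_gt0.
have [|i [j [lt_ij hij]]] := @pigeonhole_norm2 _ 1 (fun n => h (nseq n (Some 0)))
    (fun n => const_mx (z ^+ n)) _ Im2_gt0.
  by move=> n; rewrite norm2_1 zX_unit.
rewrite -raddfB norm2_1 => close_ij.
pose above m n := threshold_lang (oconcat (ab_word m n) (ocst None)).
have swap m n l : h (nseq m (Some 0)) = h (nseq n (Some 0)) -> above m l -> above n l.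
  by rewrite /above /ab_word !oconcat_cat => hmn; apply: hP.
have not_above_diag n : ~ above n n.
  by move=> /threshold_langE; rewrite conjc_mul zX_unit mulr1 ltxx.
pose e := conjc (z ^+ i) * z ^+ j.
have zi_e : z ^+ i * e = z ^+ j.
  by rewrite /e mulrA [z ^+ i * _]mulrC conjc_mul zX_unit mul1r.
have [] := @small_rotation_increases_Re e.
- by rewrite sqmodM sqmod_conjc !zX_unit mulr1.
- apply/eqP => e1; move: zi_e; rewrite e1 mulr1 => /z_aperiodic eq_ij.
  by rewrite eq_ij ltnn in lt_ij.
- by rewrite -[sqmod _]mul1r -(zX_unit i) -sqmodM mulrBr zi_e mulr1.
- by move/(threshold_langE i j).2/(swap _ _ _ hij)/not_above_diag.
have -> : conjc e = conjc (z ^+ j) * z ^+ i by rewrite conjcM conjcK mulrC.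
by move/(threshold_langE j i).2/(swap _ _ _ (esym hij))/not_above_diag.
Qed.

End ThresholdLanguage.

Definition z34 : C := Complex (3 / 5) (4 / 5).

Lemma sqmod_z34 : sqmod z34 = 1.
Proof. by rewrite /sqmod /=; field. Qed.

Lemma gauss34X_mod5 n : exists s t : int,
  (Complex 3 4 : C) ^+ n.+1 = Complex (3 + 5 * s%:~R) (4 + 5 * t%:~R).
Proof.
elim: n => [|n [s [t IHn]]]; first by exists 0, 0; rewrite expr1 !mulr0 !addr0.
exists (3 * s - 4 * t - 2), (3 * t + 4 * s + 4).
rewrite exprS IHn; apply/eqP; rewrite eq_complex /=.
by apply/andP; split; apply/eqP; ring.
Qed.

Lemma z34X_neq1 n : (0 < n)%N -> z34 ^+ n != 1.
Proof.
case: n => // n _; apply/eqP => z1; have [s [t]] := gauss34X_mod5 n.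
have -> : Complex 3 4 = z34 * 5%:C%C :> C.
  by apply/eqP; rewrite eq_complex /=; apply/andP; split; apply/eqP; field.
rewrite exprMn z1 mul1r -rmorphXn => -[_] /esym/eqP.
rewrite (_ : 4 + 5 * t%:~R = (4 + 5 * t)%:~R :> R); last by rewrite rmorphD rmorphM.
by rewrite intr_eq0 => /eqP; lia.
Qed.

Lemma z34X_inj : injective (fun n => z34 ^+ n).
Proof.
have z34X_neq0 n : z34 ^+ n != 0.
  by rewrite expf_neq0 //; apply/eqP => -[/eqP]; rewrite mulf_eq0 invr_eq0 !pnatr_eq0.
have lt_neq i j : (i < j)%N -> z34 ^+ i <> z34 ^+ j.
  move=> lt_ij; rewrite -(subnKC (ltnW lt_ij)) exprD -{1}[z34 ^+ i]mulr1.
  by move/(mulfI (z34X_neq0 i))/esym/eqP; apply/negP/z34X_neq1; rewrite subn_gt0.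
by move=> i j z_ij; have [/lt_neq|/lt_neq|//] := ltngtP i j; rewrite z_ij.
Qed.

Lemma exists_L_gt_not_omega_regular (lam : R) : 0 < lam < 1 ->
  exists A : qa (option 'I_2), ~ omega_regular (L_gt lam A).
Proof.
move=> /andP [lam_gt0 lam_lt1]; pose p := 2 * lam - 1.
pose q := Num.sqrt (1 - p ^+ 2).
have p2_lt1 : 0 < 1 - p ^+ 2.
  rewrite (_ : 1 - p ^+ 2 = 4 * (lam * (1 - lam))); last by rewrite /p; ring.
  by rewrite !mulr_gt0 ?subr_gt0.
have kappa_unit : sqmod (Complex p q) = 1.
  by rewrite /sqmod /= sqr_sqrtr ?ltW //; ring.
have kappa_Im : complex.Im (Complex p q) != 0 by rewrite gt_eqF // sqrtr_gt0.
exists (threshold_qa (Complex p q) sqmod_z34).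
have -> : lam = (1 + complex.Re (Complex p q)) / 2.
  by rewrite /= /p; field.
exact: threshold_lang_not_omega_regular z34X_inj kappa_unit kappa_Im.
Qed.

Section RecurrenceObstruction.
Variables (S : finType) (a b c : S).
Hypotheses (a_neq_b : a != b) (a_neq_c : a != c) (b_neq_c : b != c).

Lemma not_in_QBA_gt lam (L : olang S) : 0 <= lam -> L (ocst c) ->
  (forall m, L (oconcat (nseq m a) (ocst c)) -> m = 0%N) -> ~ in_QBA_gt lam L.
Proof.
move=> lam_ge0 Lc La [A LA].
have [m m_gt0 /LA] := L_gt_prepend [:: a] lam_ge0 ((LA _).1 Lc).
have -> : flatten (nseq m [:: a]) = nseq m a by elim: (m) => //= n ->.
by move/La => m0; rewrite m0 in m_gt0.
Qed.

Definition cst_lang : olang S := lconcat (eq [::]) (omega_pow (eq [:: c])).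

Lemma omega_regular_cst_lang : omega_regular cst_lang.
Proof. by apply: omega_kleene_lconcat; apply: regular_word. Qed.

Lemma cst_lang_not_QBA lam : 0 <= lam -> ~ in_QBA_gt lam cst_lang.
Proof.
move=> lam_ge0; apply: not_in_QBA_gt => // [|m].
  by apply/lconcat_letter; exists [::]; rewrite ?oconcat_nil.
move=> /lconcat_letter [_ <- /(count_oconcat_ocst a_neq_c)].
by rewrite count_nseq /= eqxx mul1n.
Qed.

Definition anbn_lang : olang S :=
  lconcat (fun u => exists n, u = nseq n a ++ nseq n b) (omega_pow (eq [:: c])).

Lemma anbn_langE i j :
  anbn_lang (oconcat (nseq i a ++ nseq j b) (ocst c)) <-> i = j.
Proof.
split=> [/lconcat_letter [_ [n ->] ij_n]|->]; last first.
  by apply/lconcat_letter; exists (nseq j a ++ nseq j b) => //; exists j.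
move: (count_oconcat_ocst a_neq_c ij_n) (count_oconcat_ocst b_neq_c ij_n).
rewrite !count_cat !count_nseq /= !eqxx (eq_sym b) (negPf a_neq_b).
by rewrite !mul1n !mul0n !addn0 !add0n => -> ->.
Qed.

Lemma omega_cf_anbn_lang : omega_cf anbn_lang.
Proof.
apply: omega_kleene_lconcat; first exact: context_free_anbn.
exact/regular_context_free/regular_word.
Qed.

Lemma anbn_lang_not_omega_regular : ~ omega_regular anbn_lang.
Proof. exact: diagonal_not_omega_regular anbn_langE. Qed.

Lemma anbn_lang_not_QBA lam : 0 <= lam -> ~ in_QBA_gt lam anbn_lang.
Proof.
move=> lam_ge0; apply: not_in_QBA_gt => // [|m].
  by have /anbn_langE := erefl 0%N; rewrite /= oconcat_nil.
by have := anbn_langE m 0; rewrite /= cats0 => -[].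
Qed.

End RecurrenceObstruction.

Theorem theorem8 :
  (* (1) *)
  (forall lam : Rdefinitions.R, 0 <= lam < 1 ->
     exists (S : finType) (L : olang S), omega_regular L /\ ~ in_QBA_gt lam L) /\
  (* (2) *)
  (forall lam : Rdefinitions.R, 0 <= lam < 1 ->
     exists (S : finType) (L : olang S),
       omega_cf L /\ ~ omega_regular L /\ ~ in_QBA_gt lam L) /\
  (* (3) *)
  (forall lam : Rdefinitions.R, 0 < lam < 1 ->
     exists (S : finType) (A : qa S), ~ omega_regular (L_gt lam A)) /\
  (* (4) *)
  (exists (S : finType) (A : qa S), ~ omega_regular (L_eq1 A)) /\
  (* (5) *)
  (exists (S : finType) (A : qa S), ~ omega_cf (L_eq1 A)).
Proof.
split=> [lam /andP [lam_ge0 _]|].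
  exists bool, (cst_lang false); split; first exact: omega_regular_cst_lang.
  exact: (@cst_lang_not_QBA _ true).
split=> [lam /andP [lam_ge0 _]|].
  exists (option bool), (anbn_lang (Some true) (Some false) None).
  split; first exact: omega_cf_anbn_lang.
  by split; [exact: anbn_lang_not_omega_regular | exact: anbn_lang_not_QBA].
split=> [lam /exists_L_gt_not_omega_regular [A not_regular]|].
  by exists (option 'I_2), A.
have not_cf : ~ omega_cf (L_eq1 (@balance_qa 3 z34 isT sqmod_z34)).
  exact: (balance_qa_not_omega_cf z34X_inj).
split; exists (option 'I_3), (@balance_qa 3 z34 isT sqmod_z34) => //.
by move/omega_regular_omega_cf.
Qed.
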